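(* Let $\lambda/\mu$ be a skew shape with $n\ge2$ cells such that $\lambda/\mu$ or its reverse is a near-hook with parameter $k$, and let $\mathrm{cDes}$ be its cyclic descent map, so that $|\mathrm{cDes}(T)|=k$ for every $T\in\mathrm{SYT}(\lambda/\mu)$. Then for every $J\subseteq[n]$ with $|J|=k$, the number $|\mathrm{cDes}^{-1}(J)|$ of $T\in\mathrm{SYT}(\lambda/\mu)$ with $\mathrm{cDes}(T)=J$ is given as follows. (a) If $\lambda/\mu$ is either $(1^k)\oplus(n-k)$ or its reverse, then $|\mathrm{cDes}^{-1}(J)|=1$. (b) If $\lambda/\mu$ is one of $(n-k,1^{k-1})\oplus(1)$, $(1)\oplus(n-k,1^{k-1})$, or their reverses, then $|\mathrm{cDes}^{-1}(J)|$ equals the number of cyclic runs in $J$. (c) If $\lambda/\mu$ is either $(n-k,2,1^{k-2})$ or its reverse, then $|\mathrm{cDes}^{-1}(J)|$ equals the number of cyclic runs in $J$ minus $1$.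
   Context: Let $[n]=\{1,\dots,n\}$. Tableaux are drawn in English notation (row 1 on top). For a skew shape $\lambda/\mu$ with $n$ cells, $\mathrm{SYT}(\lambda/\mu)$ is the set of standard Young tableaux of that shape; $\mathrm{Des}(T)=\{i\in[n-1]: i+1\text{ is in a lower row than } i\text{ in }T\}$. We write $s_1\oplus\cdots\oplus s_t$ for the skew shape with components $s_1,\dots,s_t$ ordered from southwest to northeast (consecutive $s_i$ share no row or column). The reverse of a skew shape is obtained by rotating it by $180^\circ$. The near-hooks with $n$ cells and parameter $k$ are: (a) $(1^k)\oplus(n-k)$, with $1\le k\le n-1$; (b) $(n-k,1^{k-1})\oplus(1)$ and $(1)\oplus(n-k,1^{k-1})$, with $1\le k\le n-1$; (c) $(n-k,2,1^{k-2})$, with $2\le k\le n-2$. For a near-hook with parameter $k$, or the reverse of one, every standard tableau $T$ has $|\mathrm{Des}(T)|\in\{k-1,k\}$, and its cyclic descent map is given by $\mathrm{cDes}(T)=\mathrm{Des}(T)\cup\{n\}$ if $|\mathrm{Des}(T)|=k-1$, and $\mathrm{cDes}(T)=\mathrm{Des}(T)$ if $|\mathrm{Des}(T)|=k$. A cyclic run of a set $\varnothing\subsetneq J\subsetneq[n]$ is a maximal cyclic interval $\{i,i+1,\dots,i+r\}$ (modulo $n$) contained in $J$. *)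

(* Defs.v *)
From mathcomp Require Import all_boot finmap.
Set Implicit Arguments.
Unset Strict Implicit.
Unset Printing Implicit Defensive.

Local Open Scope fset_scope.
Local Open Scope nat_scope.

(* A cell is a pair (row, column), both counted from 0.  Rows grow downwards
   (English notation) and columns grow to the right. *)
Definition diagram := {fset nat * nat}.

(* Trailing zeros are allowed; they do not change the diagram. *)
Definition is_part (lam : seq nat) : bool := sorted geq lam.

Definition part_incl (mu lam : seq nat) : Prop :=
  forall i, nth 0 mu i <= nth 0 lam i.

Definition skew (lam mu : seq nat) : diagram :=
  [fset x in [seq (i, j) | i <- iota 0 (size lam),
                j <- iota (nth 0 mu i) (nth 0 lam i - nth 0 mu i)]].

Lemma in_skew lam mu x :
  (x \in skew lam mu) = (nth 0 mu x.1 <= x.2 < nth 0 lam x.1).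
Proof.
rewrite /skew !inE; apply/allpairsPdep/idP => [[i [j [_]]]|].
  rewrite mem_iota => /andP[le_j lt_j] -> /=; rewrite le_j /=.
  have [le_ml|lt_lm] := leqP (nth 0 mu i) (nth 0 lam i).
    by rewrite subnKC in lt_j.
  rewrite (eqP (ltnW lt_lm)) addn0 in lt_j.
  by have := leq_ltn_trans le_j lt_j; rewrite ltnn.
case: x => i j /= /andP[le_j lt_j]; exists i, j; split=> //.
  rewrite mem_iota add0n /= ltnNge; apply/negP=> le_i.
  by rewrite (nth_default 0 le_i) in lt_j.
by rewrite mem_iota le_j subnKC // (leq_trans le_j (ltnW lt_j)).
Qed.

Definition straight (lam : seq nat) : diagram := skew lam [::].

Definition height (D : diagram) : nat := \max_(x <- D) x.1.+1.
Definition width (D : diagram) : nat := \max_(x <- D) x.2.+1.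

(* The rotation by 180 degrees inside the rectangle height D x width D. *)
Definition reverse (D : diagram) : diagram :=
  [fset (height D - x.1.+1, width D - x.2.+1) | x in D].

(* D1 is placed to the southwest of D2. *)
Definition dsum (D1 D2 : diagram) : diagram :=
  [fset (x.1 + height D2, x.2) | x in D1]
    `|` [fset (x.1, x.2 + width D1) | x in D2].

(* The positions of the components of a shape in the plane are immaterial as
   long as their relative order is kept: D is E up to the insertion of empty
   rows and columns (in particular, up to translation). *)
Definition has_shape (D E : diagram) : Prop :=
  exists f g : nat -> nat,
    [/\ {homo f : i j / i < j}, {homo g : i j / i < j}
      & D = [fset (f x.1, g x.2) | x in E]].

Definition near_hook_a (n k : nat) (D : diagram) : Prop :=
  1 <= k <= n - 1 /\
  has_shape D (dsum (straight (nseq k 1)) (straight [:: n - k])).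

Definition near_hook_b (n k : nat) (D : diagram) : Prop :=
  1 <= k <= n - 1 /\
  (has_shape D (dsum (straight (n - k :: nseq (k - 1) 1)) (straight [:: 1])) \/
   has_shape D (dsum (straight [:: 1]) (straight (n - k :: nseq (k - 1) 1)))).

Definition near_hook_c (n k : nat) (D : diagram) : Prop :=
  2 <= k <= n - 2 /\
  has_shape D (straight [:: n - k, 2 & nseq (k - 2) 1]).

Definition near_hook (n k : nat) (D : diagram) : Prop :=
  [\/ near_hook_a n k D, near_hook_b n k D | near_hook_c n k D].

Definition or_reverse (P : diagram -> Prop) (D : diagram) : Prop :=
  P D \/ P (reverse D).

(* The set {1, ..., n} is represented by 'I_n: the ordinal i stands for the
   integer i + 1, for tableau entries and for (cyclic) descents alike. *)

Section Tableaux.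
Variables (n : nat) (D : diagram).
Implicit Type T : {ffun D -> 'I_n}.

Definition is_syt T : bool :=
  [&& injectiveb T, [forall i, exists x, T x == i],
      [forall x : D, forall y : D,
         ((val x).1 == (val y).1) && ((val x).2 < (val y).2) ==> (T x < T y)]
    & [forall x : D, forall y : D,
         ((val x).2 == (val y).2) && ((val x).1 < (val y).1) ==> (T x < T y)]].

Definition SYT : {set {ffun D -> 'I_n}} := [set T | is_syt T].

Definition Des T : {set 'I_n} :=
  [set i : 'I_n | [exists x : D, exists y : D,
     [&& T x == i, T y == i.+1 :> nat & (val x).1 < (val y).1]]].

(* The ordinal i with i.+1 = n stands for the integer n. *)
Definition cDes (k : nat) T : {set 'I_n} :=
  if #|Des T| == k - 1 then Des T :|: [set i : 'I_n | i.+1 == n] else Des T.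

Definition cDes_fiber (k : nat) (J : {set 'I_n}) : {set {ffun D -> 'I_n}} :=
  [set T in SYT | cDes k T == J].

End Tableaux.

Section CyclicRuns.
Variable n : nat.

(* {i, i + 1, ..., i + r} modulo n *)
Definition cyc_interval (i r : 'I_n) : {set 'I_n} :=
  [set j : 'I_n | [exists t : 'I_n, (t <= r) && (j == (i + t) %% n :> nat)]].

Definition is_cyc_interval (A : {set 'I_n}) : bool :=
  [exists i, exists r, A == cyc_interval i r].

Definition cyclic_runs (J : {set 'I_n}) : {set {set 'I_n}} :=
  [set A | maxset (fun B => is_cyc_interval B && (B \subset J)) A].

End CyclicRuns.

(* Main.v *)
Require Import Defs.
From mathcomp Require Import all_boot finmap zify.

(** Only the cells, the order that standardness imposes on them and the
    comparison of their rows matter for a tableau and its descents, so a shape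
    can be replaced by a small model: two chains of cells in case (a), a hook
    with one extra cell in cases (b) and (c).  A half turn of the shape,
    combined with complementing the entries, negates cyclic descents modulo n,
    and negation preserves the number of cyclic runs; so the reverse of a shape
    needs no separate treatment.  Runs are counted by their first elements: the
    starts of J are the i in J with i - 1 not in J (cyclically), and they are
    as many as the starts of the complement of J, which are the elements that
    follow the last elements of the runs.

    Below, entries are counted from 0, i + 1 and i - 1 are cyclic, and last is
    the largest entry.

    (a) A filling of a column southwest of a row is determined by the set A of
    entries of the column, which is arbitrary of size k.  For i other than
    last, i is a descent exactly if i + 1 is in A; the rule for last makes the
    cyclic descent set equal to A - 1.  So each J arises once.

    (b), (c) A filling of a hook with an extra cell is determined by the entry
    x of the extra cell and the set L of entries of the leg (the first column
    without the corner).  Let S = L - 1, a set of k - 1 elements.  Comparing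
    rows of consecutive entries shows that the cyclic descent set is obtained
    from S by a small change near x:
    - extra cell in the northeast: add x, or last if x is already in S;
    - extra cell in the southwest: add x - 1, and replace x by last if x is
      in S;
    - inner cell: add y = x - 1, or last if y - 1 is in S.
    Hence, for a given J, the set S can be recovered from x, and T |-> x
    embeds the fiber of J into the set of entries.  The image is, respectively,
    the set of starts of J; the set of starts of the complement of J; and the
    set of all y + 1 where y is a start, but not the smallest element, of M.
    Here M is J or its complement, whichever misses last.  The subtraction of 1
    in case (c) comes from the standardness at the inner cell, which demands
    smaller entries both in the leg and in the arm; this excludes exactly the
    smallest element of M.  The three cases share [hook_distribution], and the
    fillings are produced by [hook_filling_exists]. *)

Set Implicit Arguments.
Unset Strict Implicit.
Unset Printing Implicit Defensive.

Local Open Scope fset_scope.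
Local Open Scope nat_scope.

(** * Cyclic runs *)

Section CyclicSuccessor.
Variable m : nat.
Implicit Types (i j : 'I_m.+1) (J : {set 'I_m.+1}).

Lemma ordS_max : ordS (@ord_max m) = ord0.
Proof. by apply: val_inj; rewrite /= modnn. Qed.

Lemma ord_pred0 : ord_pred (@ord0 m) = ord_max.
Proof. by rewrite -ordS_max ordSK. Qed.

Lemma val_ordS i : i != ord_max -> ordS i = i.+1 :> nat.
Proof.
by move=> i_max; rewrite /= modn_small // ltnS ltn_neqAle i_max -ltnS ltn_ord.
Qed.

Lemma val_ord_pred i : i != ord0 -> (ord_pred i).+1 = i :> nat.
Proof.
move=> i0; have {2}<- := ord_predK i; rewrite val_ordS //.
by apply: contraNneq i0 => e; rewrite -ordS_max -e ord_predK.
Qed.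

Lemma ordS_eq i j : (ordS i == j) = (i == ord_pred j).
Proof. exact: (can2_eq (@ordSK _) (@ord_predK _)). Qed.

Lemma ord_pred_neq i : 0 < m -> ord_pred i != i.
Proof.
move=> m_gt0; have [->|i0] := eqVneq i ord0.
  by rewrite ord_pred0 -val_eqE /= -lt0n.
by apply/eqP=> e; have := val_ord_pred i0; rewrite e; lia.
Qed.

Lemma iter_ordS t i : iter t (@ordS m.+1) i = (i + t) %% m.+1 :> nat.
Proof.
elim: t => [|t IHt] /=; first by rewrite addn0 modn_small.
by rewrite IHt addnS -addn1 modnDml addn1.
Qed.

Lemma iter_ordS_inj i t t' : t <= m -> t' <= m ->
  iter t (@ordS m.+1) i = iter t' (@ordS m.+1) i -> t = t'.
Proof.
move=> tm tm' /(congr1 val); rewrite /= !iter_ordS => /eqP.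
by rewrite eqn_modDl !modn_small // => /eqP.
Qed.

(** The predecessor is reached by going once around the cycle, one step short. *)
Lemma iter_ordS_pred i : iter m (@ordS m.+1) i = ord_pred i.
Proof.
apply: (can_inj (@ordSK m.+1)); rewrite ord_predK; apply: val_inj.
by apply: etrans (iter_ordS m.+1 i) _; rewrite modnDr modn_small.
Qed.
End CyclicSuccessor.

Section Runs.
Variable m : nat.
Implicit Types (i j : 'I_m.+1) (J : {set 'I_m.+1}).

Definition starts J := [set i in J | ord_pred i \notin J].

Lemma in_starts J i : (i \in starts J) = (i \in J) && (ord_pred i \notin J).
Proof. by rewrite inE. Qed.

Lemma cyc_intervalP i (r : 'I_m.+1) j :
  reflect (exists2 t, t <= r & j = iter t (@ordS m.+1) i)
          (j \in cyc_interval i r).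
Proof.
rewrite inE; apply: (iffP existsP) => [[t /andP[tr /eqP e]]|[t tr ->]].
  by exists t => //; apply: val_inj; rewrite /= iter_ordS.
have tm : t < m.+1 by apply: leq_ltn_trans tr (ltn_ord r).
by exists (Ordinal tm); rewrite tr iter_ordS /=.
Qed.

(** A cyclic interval inside J is maximal as soon as it cannot be prolonged by
    one element at either end, because a larger cyclic interval contains one of
    the two neighbouring elements. *)
Lemma runP J A : J != setT ->
  reflect (exists i (r : 'I_m.+1),
     [/\ A = cyc_interval i r, A \subset J, i \in starts J
       & iter r.+1 (@ordS m.+1) i \notin J])
    (A \in cyclic_runs J).
Proof.
move=> JT; rewrite inE; apply: (iffP maxsetP).
  move=> [/andP[/existsP[i /existsP[r /eqP eA]] AJ] Amax].
  have memA t : t <= r -> iter t (@ordS m.+1) i \in A.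
    by move=> tr; rewrite eA; apply/cyc_intervalP; exists t.
  have r_lt : r < m.
    rewrite ltn_neqAle -ltnS ltn_ord andbT; apply: contraNneq JT => r_m.
    rewrite -subTset; apply: subset_trans AJ; apply/subsetP=> j _.
    rewrite eA; apply/cyc_intervalP.
    exists ((j + m.+1 - i) %% m.+1); first by rewrite r_m -ltnS ltn_mod.
    apply: val_inj; rewrite /= iter_ordS modnDmr subnKC ?modnDr ?modn_small //.
    exact: leq_trans (ltnW (ltn_ord i)) (leq_addl _ _).
  (* The interval has fewer than n elements, so it does not wrap onto itself. *)
  have notA t : r < t <= m -> iter t (@ordS m.+1) i \notin A.
    move=> /andP[rt tm]; rewrite eA; apply/cyc_intervalP=> -[t' tr].
    by move/iter_ordS_inj; lia.
  exists i, r; split=> //.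
    rewrite inE (subsetP AJ) ?(memA 0) //=; apply/negP=> iJ.
    have r1 : r.+1 < m.+1 by [].
    pose B := cyc_interval (ord_pred i) (Ordinal r1).
    have memB t : t <= r -> iter t (@ordS m.+1) i \in B.
      move=> tr; apply/cyc_intervalP; exists t.+1 => //.
      by rewrite iterSr ord_predK.
    have eBA : B = A.
      apply: Amax; last first.
        by apply/subsetP=> j; rewrite eA => /cyc_intervalP[t tr ->]; apply: memB.
      apply/andP; split; first by apply/existsP; exists (ord_pred i);
        apply/existsP; exists (Ordinal r1).
      apply/subsetP=> j /cyc_intervalP[[_ ->|t /= tr ->]] //.
      by rewrite (subsetP AJ) // -iterS iterSr ord_predK memA.
    have /negP[] := notA m ltac:(lia).
    rewrite iter_ordS_pred -eBA; apply/cyc_intervalP; by exists 0.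
  apply/negP=> iJ.
  have r1 : r.+1 < m.+1 by [].
  pose B := cyc_interval i (Ordinal r1).
  have eBA : B = A.
    apply: Amax; last first.
      apply/subsetP=> j; rewrite eA => /cyc_intervalP[t tr ->].
      by apply/cyc_intervalP; exists t => //; apply: leqW.
    apply/andP; split; first by apply/existsP; exists i;
      apply/existsP; exists (Ordinal r1).
    apply/subsetP=> j /cyc_intervalP[t /=].
    rewrite leq_eqVlt => /predU1P[-> -> //|tr ->].
    by rewrite (subsetP AJ) // memA.
  have /negP[] := notA r.+1 ltac:(lia).
  by rewrite -eBA; apply/cyc_intervalP; exists r.+1.
move=> [i [r [eA AJ]]]; rewrite inE => /andP[iJ predJ] endJ.
split=> [|B /andP[/existsP[i' /existsP[r' /eqP eB]] BJ] AB].
  by rewrite AJ andbT; apply/existsP; exists i; apply/existsP; exists r; apply/eqP.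
have /cyc_intervalP[t tr ei] : i \in cyc_interval i' r'.
  by rewrite -eB (subsetP AB) // eA; apply/cyc_intervalP; exists 0.
have t0 : t = 0.
  case: t tr ei => // t tr ei; case/negP: predJ; rewrite ei /= ordSK.
  by rewrite (subsetP BJ) // eB; apply/cyc_intervalP; exists t => //; apply: ltnW.
apply/eqP; rewrite eqEsubset AB andbT; apply/subsetP=> j.
rewrite eB eA => /cyc_intervalP[t' tr' ->]; apply/cyc_intervalP.
rewrite {t tr}t0 /= in ei; rewrite -ei; exists t' => //.
rewrite leqNgt; apply: contra endJ => rt; rewrite (subsetP BJ) // eB ei.
by apply/cyc_intervalP; exists r.+1 => //; apply: leq_trans rt tr'.
Qed.

Lemma run_start J i (r : 'I_m.+1) :
  cyc_interval i r \subset J -> i \in starts J ->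
  cyc_interval i r :&: starts J = [set i].
Proof.
move=> /subsetP sJ iJ; apply/setP=> j; rewrite in_set1 in_setI.
apply/andP/eqP=> [[/cyc_intervalP[[|t] tr ->] //]|->].
  rewrite in_starts /= ordSK => /andP[_ /negP[]]; apply: sJ.
  by apply/cyc_intervalP; exists t => //; apply: ltnW.
by split=> //; apply/cyc_intervalP; exists 0.
Qed.

Lemma run_from_start J i : i \in starts J ->
  exists2 r : 'I_m.+1, cyc_interval i r \subset J
                    & iter r.+1 (@ordS m.+1) i \notin J.
Proof.
rewrite in_starts => /andP[iJ pJ].
have m_gt0 : 0 < m.
  rewrite lt0n; apply: contraNneq pJ => m0; rewrite (_ : ord_pred i = i) //.
  by apply: ord_inj; move: (ltn_ord i) (ltn_ord (ord_pred i)) m0; lia.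
have ex_end : exists r, iter r.+1 (@ordS m.+1) i \notin J.
  by exists m.-1; rewrite prednK // iter_ordS_pred.
case: (ex_minnP ex_end) => r end_r min_r.
have r_lt : r < m.+1.
  rewrite ltnS; apply: leq_trans (leq_pred m); apply: min_r.
  by rewrite prednK // iter_ordS_pred.
exists (Ordinal r_lt) => //; apply/subsetP=> j /cyc_intervalP[[|t] /= tr ->] //.
by apply/negPn/negP=> /min_r; lia.
Qed.

(** Each run contains exactly one start, and each start begins a run; the length
    of a run is forced since the element after its end is outside J. *)
Lemma card_cyclic_runs J : J != setT -> #|cyclic_runs J| = #|starts J|.
Proof.
move=> JT; pose start (A : {set 'I_m.+1}) := odflt ord0 [pick i in A :&: starts J].
have startE i (r : 'I_m.+1) : cyc_interval i r \subset J -> i \in starts J ->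
    start (cyc_interval i r) = i.
  move=> sJ iJ; rewrite /start; case: pickP => [j|/(_ i)].
    by rewrite run_start // in_set1 => /eqP.
  by rewrite run_start // in_set1 eqxx.
rewrite -(_ : start @: cyclic_runs J = starts J); last first.
  apply/setP=> i; apply/imsetP/idP=> [[A /(runP _ JT)[j [r [-> AJ jJ _]]] ->]|iJ].
    by rewrite startE // -A.
  have [r sJ end_r] := run_from_start iJ.
  exists (cyc_interval i r); last by rewrite startE.
  by apply/(runP _ JT); exists i, r.
rewrite card_in_imset // => A B.
move=> /(runP _ JT)[i [r [-> AJ iJ endA]]] /(runP _ JT)[j [s [-> BJ jJ endB]]].
rewrite !startE // => ij; rewrite -{j}ij in BJ jJ endB *.
have [rs|sr|/ord_inj -> //] := ltngtP r s.
  by case/negP: endA; apply: (subsetP BJ); apply/cyc_intervalP; exists r.+1.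
by case/negP: endB; apply: (subsetP AJ); apply/cyc_intervalP; exists s.+1.
Qed.

(** J and its shift by one have the same size, hence so have their two
    differences, which are the two sets of starts. *)
Lemma card_starts_compl J : #|starts (~: J)| = #|starts J|.
Proof.
pose PJ := @ord_pred m.+1 @^-1: J.
have cPJ : #|PJ| = #|J| by apply: card_preimset; apply: can_inj (@ord_predK _).
rewrite (_ : starts J = J :\: PJ); last by apply/setP=> i; rewrite !inE andbC.
rewrite (_ : starts (~: J) = PJ :\: J); last first.
  by apply/setP=> i; rewrite !inE negbK.
by rewrite !cardsD cPJ setIC.
Qed.

(** For the integer i + 1 that the ordinal i stands for, this is negation
    modulo n. *)
Definition cyc_neg i : 'I_m.+1 := ord_pred (rev_ord i).

Lemma cyc_negS i : cyc_neg (ordS i) = ord_pred (cyc_neg i).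
Proof.
congr ord_pred; rewrite /cyc_neg.
have [->|i_max] := eqVneq i ord_max.
  rewrite ordS_max (_ : rev_ord ord_max = ord0); last first.
    by apply: val_inj; rewrite /= subnn.
  by rewrite ord_pred0; apply: ord_inj; rewrite /= subn1.
have r0 : rev_ord i != ord0.
  by apply: contra i_max; rewrite -!val_eqE /= => /eqP e; have := ltn_ord i; lia.
apply: ord_inj; apply: succn_inj; rewrite val_ord_pred //.
change ((m.+1 - (ordS i).+1).+1 = m.+1 - i.+1); rewrite val_ordS //.
move: i_max; rewrite -val_eqE /=; have := ltn_ord i; lia.
Qed.

Lemma cyc_neg_inj : injective cyc_neg.
Proof. by move=> i j /(can_inj (@ord_predK _)) /rev_ord_inj. Qed.

Lemma cyc_neg_max : cyc_neg ord_max = ord_max.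
Proof.
rewrite /cyc_neg -[in RHS]ord_pred0; congr ord_pred.
by apply: ord_inj; rewrite /= subnn.
Qed.

Lemma card_starts_neg J : #|starts (cyc_neg @^-1: J)| = #|starts J|.
Proof.
rewrite -(card_starts_compl J).
rewrite -(card_preimset (starts (~: J)) (@ordS_inj m.+1)).
rewrite -[RHS](card_preimset _ cyc_neg_inj).
apply: eq_card => i; rewrite !inE ordSK negbK andbC; congr (_ && _).
by congr (_ \notin J); rewrite -[in RHS](ord_predK i) cyc_negS ord_predK.
Qed.
End Runs.

(** * Tableaux on abstract finite sets of cells *)

(** The relation [lt] collects the strict inequalities that standardness imposes,
    and [above] compares rows; a diagram and a model of it differ only in the
    cells. *)
Section Tableaux.
Variables (X : finType) (lt above : rel X) (n : nat).
Implicit Type T : {ffun X -> 'I_n}.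

Definition standard T : bool :=
  [&& injectiveb T, [forall i, exists x, T x == i]
    & [forall x, forall y, lt x y ==> (T x < T y)]].

Definition descents T : {set 'I_n} :=
  [set i : 'I_n | [exists x, exists y,
     [&& T x == i, T y == i.+1 :> nat & above x y]]].

Definition cyclic_descents (k : nat) T : {set 'I_n} :=
  if #|descents T| == k - 1 then descents T :|: [set i : 'I_n | i.+1 == n]
  else descents T.

Definition cyclic_fiber (k : nat) (J : {set 'I_n}) : {set {ffun X -> 'I_n}} :=
  [set T | standard T & cyclic_descents k T == J].

Definition cyclic_distribution (k : nat) (N : {set 'I_n} -> nat) : Prop :=
  (forall T, standard T -> #|cyclic_descents k T| = k) /\
  (forall J : {set 'I_n}, #|J| = k -> #|cyclic_fiber k J| = N J).

Lemma standardP T :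
  reflect [/\ injective T, forall i, exists x, T x = i
             & forall x y, lt x y -> T x < T y]
          (standard T).
Proof.
apply: (iffP and3P) => -[T_inj T_surj T_mono]; split.
- exact/injectiveP.
- by move=> i; have /existsP[x /eqP] := forallP T_surj i; exists x.
- by move=> x y; apply: implyP; move/forallP/(_ x)/forallP: T_mono.
- exact/injectiveP.
- by apply/forallP=> i; apply/existsP; have [x <-] := T_surj i; exists x.
- by apply/forallP=> x; apply/forallP=> y; apply/implyP/T_mono.
Qed.
End Tableaux.

Lemma mem_descents (X : finType) (above : rel X) (m : nat)
    (T : {ffun X -> 'I_m.+1}) x y :
  injective T -> T x != ord_max -> T y = ordS (T x) ->
  (T x \in descents above T) = above x y.
Proof.
move=> T_inj x_max xy; rewrite inE.
apply/existsP/idP => [[x' /existsP[y' /and3P[/eqP/T_inj-> /eqP y'E]]]|ab].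
  by rewrite (T_inj y' y) //; apply: ord_inj; rewrite y'E xy val_ordS.
by exists x; apply/existsP; exists y; rewrite eqxx ab xy val_ordS // eqxx.
Qed.

Lemma max_descents (X : finType) (above : rel X) (m : nat)
    (T : {ffun X -> 'I_m.+1}) : ord_max \notin descents above T.
Proof.
rewrite inE; apply/existsP=> -[x /existsP[y /and3P[_ /eqP /= e _]]].
by have := ltn_ord (T y); rewrite e ltnn.
Qed.

(** If a set J of size k agrees with the descents below the last entry, then the
    last entry is in J exactly if there are k - 1 descents; so J is the set of
    cyclic descents. *)
Lemma cyclic_descentsE (X : finType) (above : rel X) (m k : nat)
    (T : {ffun X -> 'I_m.+1}) (J : {set 'I_m.+1}) :
  0 < k -> #|J| = k -> descents above T = J :\ ord_max ->
  cyclic_descents above k T = J.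
Proof.
move=> k_gt0 cJ eD; rewrite /cyclic_descents eD.
rewrite (_ : [set i : 'I_m.+1 | i.+1 == m.+1] = [set ord_max]); last first.
  by apply/setP=> i; rewrite !inE.
have := cardsD1 ord_max J; rewrite cJ.
have [mJ|mJ] := boolP (ord_max \in J); rewrite /= => card_J.
  by rewrite ifT; [rewrite setUC setD1K | rewrite card_J addKn].
rewrite ifF; last by rewrite -[#|_|]add0n -card_J -{1}(subnK k_gt0) addn1 gtn_eqF.
by apply/setP=> i; rewrite !inE andb_idl // => iJ; apply: contraNneq mJ => <-.
Qed.

Section Isomorphism.
Variables (X Y : finType) (ltX aboveX : rel X) (ltY aboveY : rel Y) (h : X -> Y).
Hypotheses (h_inj : injective h) (h_surj : forall y, exists x, h x = y).
Hypotheses (h_lt : forall x y, ltY (h x) (h y) = ltX x y)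
           (h_above : forall x y, aboveY (h x) (h y) = aboveX x y).

Lemma cyclic_distribution_iso n k N :
  cyclic_distribution ltX aboveX (n := n) k N ->
  cyclic_distribution ltY aboveY k N.
Proof.
have ex_h y : exists x, h x == y by have [x <-] := h_surj y; exists x.
pose g y := xchoose (ex_h y).
have gK : cancel g h by move=> y; apply/eqP/(xchooseP (ex_h y)).
have hK : cancel h g by move=> x; apply: h_inj; rewrite gK.
pose pull (T : {ffun Y -> 'I_n}) := [ffun x => T (h x)].
have pull_bij : bijective pull.
  exists (fun T : {ffun X -> 'I_n} => [ffun y => T (g y)]) => T;
    by apply/ffunP=> x; rewrite !ffunE ?gK ?hK.
have std_pull T : standard ltX (pull T) = standard ltY T.
  apply/standardP/standardP => -[T_inj T_surj T_mono]; split.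
  - move=> y y' e; rewrite -(gK y) -(gK y'); congr h.
    by apply: T_inj; rewrite !ffunE !gK.
  - by move=> i; have [x] := T_surj i; rewrite ffunE; exists (h x).
  - move=> y y'; rewrite -(gK y) -(gK y') h_lt => /T_mono.
    by rewrite !ffunE.
  - by move=> x x'; rewrite !ffunE => /T_inj/h_inj.
  - by move=> i; have [y <-] := T_surj i; exists (g y); rewrite ffunE gK.
  - by move=> x x' lt_xx'; rewrite !ffunE; apply: T_mono; rewrite h_lt.
have desc_pull T : descents aboveX (pull T) = descents aboveY T.
  apply/setP=> i; rewrite !inE; apply/existsP/existsP.
    move=> [x /existsP[x' /and3P[]]]; rewrite !ffunE => xi x'i ab.
    by exists (h x); apply/existsP; exists (h x'); rewrite xi x'i h_above.
  move=> [y /existsP[y' /and3P[yi y'i ab]]].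
  exists (g y); apply/existsP; exists (g y').
  by rewrite !ffunE !gK yi y'i -h_above !gK.
have cdesc_pull T : cyclic_descents aboveX k (pull T) = cyclic_descents aboveY k T.
  by rewrite /cyclic_descents desc_pull.
move=> [card_cdesc card_fiber]; split=> [T std_T|J cJ].
  by rewrite -cdesc_pull card_cdesc ?std_pull.
rewrite -card_fiber // -(on_card_preimset (f := pull)).
  by apply: eq_card => T; rewrite !inE std_pull cdesc_pull.
exact: onW_bij.
Qed.
End Isomorphism.

Section Reversal.
Variables (X : finType) (lt above : rel X) (m : nat).

(** When the order of cells and of rows is reversed and the entries are
    complemented, a descent i (counted from 1) becomes the descent n - i, and |Des|
    is unchanged; hence cyclic descents are negated modulo n. *)
Lemma cyclic_distribution_rev (k : nat) (N : {set 'I_m.+1} -> nat) :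
  (forall J : {set 'I_m.+1}, N (@cyc_neg m @^-1: J) = N J) ->
  cyclic_distribution lt above k N ->
  cyclic_distribution (fun x y => lt y x) (fun x y => above y x) k N.
Proof.
move=> N_neg.
pose neg (T : {ffun X -> 'I_m.+1}) := [ffun x => rev_ord (T x)].
have negK : involutive neg by move=> T; apply/ffunP=> x; rewrite !ffunE rev_ordK.
have std_neg T : standard lt (neg T) -> standard (fun x y => lt y x) T.
  move=> /standardP[T_inj T_surj T_mono]; apply/standardP; split.
  - by move=> x y e; apply: T_inj; rewrite !ffunE e.
  - move=> i; have [x] := T_surj (rev_ord i).
    by rewrite ffunE => /rev_ord_inj; exists x.
  - by move=> x y /T_mono; rewrite !ffunE /=; have := ltn_ord (T x); lia.
have neg_std T : standard (fun x y => lt y x) T -> standard lt (neg T).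
  move=> /standardP[T_inj T_surj T_mono]; apply/standardP; split.
  - by move=> x y; rewrite !ffunE => /rev_ord_inj/T_inj.
  - move=> i; have [x e] := T_surj (rev_ord i).
    by exists x; rewrite ffunE e rev_ordK.
  - by move=> x y /T_mono; rewrite !ffunE /=; have := ltn_ord (T x); lia.
have desc_neg T : standard (fun x y => lt y x) T ->
    descents (fun x y => above y x) T = @cyc_neg m @^-1: descents above (neg T).
  move=> std_T; have /standardP[nT_inj _ _] := neg_std T std_T.
  have /standardP[T_inj T_surj _] := std_T.
  apply/setP=> i; rewrite [RHS]in_set.
  have [->|i_max] := eqVneq i ord_max.
    by rewrite cyc_neg_max !(negPf (max_descents _ _)).
  have [x xi] := T_surj i; have [y yi] := T_surj (ordS i).
  have nyi : neg T y = cyc_neg i.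
    rewrite ffunE yi; apply: (can_inj (@ord_predK m.+1)).
    by rewrite -[ord_pred (rev_ord _)]/(cyc_neg (ordS i)) cyc_negS.
  have x_max : T x != ord_max by rewrite xi.
  have Tyx : T y = ordS (T x) by rewrite xi.
  rewrite -{1}xi (mem_descents _ T_inj x_max Tyx) -nyi.
  have ny_max : neg T y != ord_max.
    by rewrite nyi -[X in _ != X]cyc_neg_max (inj_eq (@cyc_neg_inj m)).
  by rewrite (mem_descents (y := x) _ nT_inj ny_max) // nyi ffunE xi ord_predK.
have cdesc_neg T : standard (fun x y => lt y x) T ->
    cyclic_descents (fun x y => above y x) k T
      = @cyc_neg m @^-1: cyclic_descents above k (neg T).
  move=> std_T; rewrite /cyclic_descents desc_neg //.
  rewrite (card_preimset _ (@cyc_neg_inj m)); case: ifP => // _.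
  rewrite preimsetU; congr (_ :|: _); apply/setP=> i; rewrite !inE.
  rewrite -[LHS]/(i == ord_max) -[RHS]/(cyc_neg i == ord_max).
  by rewrite -[in RHS]cyc_neg_max (inj_eq (@cyc_neg_inj m)).
move=> [card_cdesc card_fiber]; split=> [T std_T|J cJ].
  by rewrite cdesc_neg // (card_preimset _ (@cyc_neg_inj m)) card_cdesc // neg_std.
pose J' := @cyc_neg m @: J.
have eJ : @cyc_neg m @^-1: J' = J.
  by apply/setP=> i; rewrite inE mem_imset //; apply: cyc_neg_inj.
rewrite -eJ N_neg -card_fiber; last by rewrite card_imset //; apply: cyc_neg_inj.
rewrite -(card_preimset (cyclic_fiber lt above k J') (inv_inj negK)).
apply: eq_card => T; rewrite !inE; apply/andP/andP=> -[std_T /eqP cd].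
  split; first exact: neg_std.
  move: cd; rewrite cdesc_neg // => /setP cd; apply/eqP/setP=> j.
  have [i ->] : exists i, j = cyc_neg i.
    by exists (rev_ord (ordS j)); rewrite /cyc_neg rev_ordK ordSK.
  by have := cd i; rewrite !inE.
have std_T' := std_neg T std_T.
by split=> //; rewrite cdesc_neg // cd.
Qed.
End Reversal.

(** * Fillings increasing along chains *)

Lemma sorted_enum_ord n (A : {set 'I_n}) :
  sorted (fun i j : 'I_n => i < j) (enum A).
Proof.
rewrite {1}/enum_mem -enumT; apply: sorted_filter.
  by move=> j i k; apply: ltn_trans.
have : sorted ltn (map val (enum 'I_n)) by rewrite val_enum_ord iota_ltn_sorted.
by rewrite sorted_map.
Qed.

(** Cells of one colour form a chain, in which [pos] is the position.  A filling
    increasing along the chains amounts to a word that colours the entries. *)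
Section Chains.
Variables (X : finType) (C : eqType) (color : X -> C) (pos : X -> nat) (m : nat).
Hypothesis chain_cell_inj :
  forall x y, color x = color y -> pos x = pos y -> x = y.
Implicit Type T : {ffun X -> 'I_m.+1}.

Definition chain_increasing T : Prop :=
  forall x y, color x = color y -> pos x < pos y -> T x < T y.

(** The smallest entry where the fillings disagree lies in one chain, at different
    positions for T and T'; the earlier of the two cells then has a smaller entry,
    on which they disagree as well. *)
Lemma chain_filling_unique T T' :
  injective T' ->
  (forall i, exists x, T x = i) -> (forall i, exists x, T' x = i) ->
  chain_increasing T -> chain_increasing T' ->
  (forall x y, T x = T' y -> color x = color y) -> T = T'.
Proof.
move=> T'_inj T_surj T'_surj T_incr T'_incr same_color.
have agree v : forall x, val (T x) = v -> T' x = T x.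
  elim/ltn_ind: v => v IHv x Tx.
  have [y T'y] := T'_surj (T x); have xy := same_color x y (esym T'y).
  have [pxy|pyx|pxy] := ltngtP (pos x) (pos y).
  - have T'x := T'_incr _ _ xy pxy; have [z Tz] := T_surj (T' x).
    have Tz_lt : T z < v by rewrite Tz -Tx -T'y.
    have /T'_inj zx : T' z = T' x := etrans (IHv _ Tz_lt _ erefl) Tz.
    by rewrite T'y -Tz zx ltnn in T'x.
  - have Ty := T_incr _ _ (esym xy) pyx; rewrite Tx in Ty.
    by have := IHv _ Ty y erefl; rewrite T'y => e; rewrite -e Tx ltnn in Ty.
  - by rewrite [in LHS](chain_cell_inj xy pxy) T'y.
by apply/ffunP=> x; rewrite (agree (T x)).
Qed.

(** Each chain receives the entries of its colour in increasing order. *)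
Lemma chain_filling_exists (w : 'I_m.+1 -> C) :
  #|X| = m.+1 -> (forall x, pos x < #|[set v | w v == color x]|) ->
  exists T, [/\ injective T, forall i, exists x, T x = i,
                chain_increasing T & forall x, w (T x) = color x].
Proof.
move=> cX pos_lt; pose cls x := enum [set v | w v == color x].
have pos_sz x : pos x < size (cls x) by rewrite -cardE.
pose T := [ffun x => nth ord0 (cls x) (pos x)].
have wT x : w (T x) = color x.
  by have := mem_nth ord0 (pos_sz x); rewrite mem_enum inE -/(cls x) ffunE => /eqP.
have T_incr : chain_increasing T.
  move=> x y xy pxy; rewrite !ffunE /cls xy.
  have tr : transitive (fun i j : 'I_m.+1 => i < j) by move=> j i k; apply: ltn_trans.
  apply: (sorted_ltn_nth tr ord0 (sorted_enum_ord _)) => //; rewrite inE.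
    by have := pos_sz x; rewrite /cls xy.
  exact: pos_sz.
have T_inj : injective T.
  move=> x y Txy; have xy : color x = color y by rewrite -!wT Txy.
  apply: chain_cell_inj => //.
  have [pxy|pyx|//] := ltngtP (pos x) (pos y).
    by have := T_incr _ _ xy pxy; rewrite Txy ltnn.
  by have := T_incr _ _ (esym xy) pyx; rewrite Txy ltnn.
exists T; split=> // i.
have [T' TK KT] : bijective T by apply: inj_card_bij; rewrite // card_ord cX.
by exists (T' i).
Qed.
End Chains.

(** * A column southwest of a row *)

Section ColumnRow.
Variables p q m : nat.
Hypotheses (pq : p + q = m.+1) (p_gt0 : 0 < p).
Local Notation cell := ('I_p + 'I_q)%type.

Definition lt_column_row (x y : cell) : bool :=
  match x, y with
  | inl i, inl j => i < j
  | inr i, inr j => i < j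
  | _, _ => false
  end.

Definition above_column_row (x y : cell) : bool :=
  match x, y with
  | inl i, inl j => i < j
  | inr _, inl _ => true
  | _, inr _ => false
  end.

Definition in_column (x : cell) : bool := if x is inl _ then true else false.
Definition column_row_pos (x : cell) : nat :=
  match x with inl i => i | inr j => j end.

Lemma column_row_cell_inj x y :
  in_column x = in_column y -> column_row_pos x = column_row_pos y -> x = y.
Proof. by case: x y => [i|i] [j|j] //= _ /ord_inj ->. Qed.

Lemma chain_lt_column_row x y :
  (in_column x = in_column y /\ column_row_pos x < column_row_pos y)
    <-> lt_column_row x y.
Proof. by case: x y => [i|i] [j|j] //=; split=> [[]|]. Qed.

Definition shifted_column (T : {ffun cell -> 'I_m.+1}) : {set 'I_m.+1} :=
  [set i | ordS i \in [set T (inl a) | a : 'I_p]].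

Lemma mem_column (T : {ffun cell -> 'I_m.+1}) x :
  injective T -> (T x \in [set T (inl a) | a : 'I_p]) = in_column x.
Proof.
move=> T_inj; apply/imsetP/idP => [[a _ /T_inj-> //]|].
by case: x => // a _; exists a.
Qed.

Lemma card_shifted_column (T : {ffun cell -> 'I_m.+1}) :
  injective T -> #|shifted_column T| = p.
Proof.
move=> T_inj; rewrite (card_preimset _ (@ordS_inj m.+1)).
by rewrite card_imset ?card_ord // => a b /T_inj[].
Qed.

(** An entry of the column lies below its predecessor: the row is above the whole
    column, and the column increases downwards.  An entry of the row does not. *)
Lemma column_row_cyclic_descents T :
  standard lt_column_row T ->
  cyclic_descents above_column_row p T = shifted_column T.
Proof.
move=> /standardP[T_inj T_surj T_mono].
apply: cyclic_descentsE => //; first exact: card_shifted_column.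
apply/setP=> i; rewrite in_setD1.
have [->|i_max /=] := eqVneq i ord_max; first exact/negbTE/max_descents.
have [x xi] := T_surj i; have [y yi] := T_surj (ordS i).
have x_max : T x != ord_max by rewrite xi.
have Tyx : T y = ordS (T x) by rewrite xi.
have ltT : T x < T y by rewrite Tyx val_ordS.
rewrite [in RHS]inE -yi mem_column // -xi (mem_descents _ T_inj x_max Tyx).
case: x y {xi yi x_max Tyx} ltT => [a|a] [b|b] //= ltT.
rewrite ltnNge; apply/negP=> ba.
have [/ord_inj ab|ab] : a = b :> nat \/ b < a by lia.
  by rewrite ab ltnn in ltT.
by have := ltn_trans ltT (T_mono (inl b) (inl a) ab); rewrite ltnn.
Qed.

Lemma column_row_distribution :
  cyclic_distribution lt_column_row above_column_row (n := m.+1) p (fun=> 1).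
Proof.
split=> [T std_T|J cJ].
  by rewrite column_row_cyclic_descents // card_shifted_column //; case/standardP: std_T.
pose w i := ord_pred i \in J.
have std_incr T : standard lt_column_row T ->
    chain_increasing in_column column_row_pos (m := m) T.
  move=> /standardP[_ _ T_mono] x y xy pxy.
  by apply: T_mono; apply/chain_lt_column_row.
have fiberE T : T \in cyclic_fiber lt_column_row above_column_row p J ->
    forall x, w (T x) = in_column x.
  rewrite inE => /andP[std_T]; rewrite column_row_cyclic_descents // => /eqP eJ x.
  have /standardP[T_inj _ _] := std_T.
  by rewrite /w -eJ inE ord_predK mem_column.
have [||T [T_inj T_surj T_incr wT]] := chain_filling_exists column_row_cell_inj (w := w).
- by rewrite card_sum !card_ord.
- move=> x.
  have cw : #|[set v | w v]| = p.
    by rewrite -[RHS]cJ -(card_preimset J (can_inj (@ord_predK m.+1))).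
  case: x => [a|b] /=.
    rewrite (_ : [set v | w v == true] = [set v | w v]) ?cw //.
    by apply/setP=> v; rewrite !inE eqb_id.
  rewrite (_ : [set v | w v == false] = ~: [set v | w v]).
    by rewrite cardsCs setCK cw card_ord -pq addKn.
  by apply/setP=> v; rewrite !inE eqbF_neg.
have std_T : standard lt_column_row T.
  by apply/standardP; split=> // x y /chain_lt_column_row[]; apply: T_incr.
have fib_T : T \in cyclic_fiber lt_column_row above_column_row p J.
  rewrite inE std_T column_row_cyclic_descents //=; apply/eqP/setP=> i.
  by have [x xi] := T_surj (ordS i); rewrite inE -xi mem_column // -wT xi /w ordSK.
apply/eqP/cards1P; exists T; apply/setP=> T'; rewrite in_set1.
apply/idP/eqP=> [fib_T'|-> //].
have std_T' : standard lt_column_row T' by move: fib_T'; rewrite inE => /andP[].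
have /standardP[_ T'_surj _] := std_T'.
apply: (chain_filling_unique column_row_cell_inj T_inj T'_surj T_surj
          (std_incr _ std_T') T_incr).
by move=> x y e; rewrite -(fiberE _ fib_T') -(fiberE _ fib_T) e.
Qed.
End ColumnRow.

(** * A hook and one extra cell *)

(** The hook has a leg of p cells, which is its first column without the corner,
    and an arm of q cells, which is its first row including the corner.  [None] is
    the extra cell. *)
Section Hook.
Variables p q m : nat.
Hypotheses (pq : p + q = m) (q_gt0 : 0 < q).
Local Notation cell := (option ('I_p + 'I_q)).
Local Notation leg a := (Some (inl a)).
Local Notation arm b := (Some (inr b)).
Implicit Types (T : {ffun cell -> 'I_m.+1}) (S J : {set 'I_m.+1}).

Definition is_leg (c : cell) : bool := if c is leg _ then true else false.

Definition hook_color (c : cell) : option bool :=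
  if c is Some _ then Some (is_leg c) else None.

Definition hook_pos (c : cell) : nat :=
  match c with leg a => a | arm b => b | None => 0 end.

Definition lt_hook (c d : cell) : bool :=
  match c, d with
  | leg a, leg b => a < b
  | arm a, arm b => a < b
  | arm a, leg _ => a == 0 :> nat
  | _, _ => false
  end.

Lemma hook_cell_inj c d :
  hook_color c = hook_color d -> hook_pos c = hook_pos d -> c = d.
Proof. by case: c d => [[a|a]|] [[b|b]|] //= _ /ord_inj ->. Qed.

Lemma hook_chain_lt c d :
  hook_color c = hook_color d -> hook_pos c < hook_pos d -> lt_hook c d.
Proof. by case: c d => [[a|a]|] [[b|b]|]. Qed.

Definition legs T : {set 'I_m.+1} := [set T (leg a) | a : 'I_p].

Definition shifted_legs T : {set 'I_m.+1} := [set i | ordS i \in legs T].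

(** The constraints that the hook puts on S, its leg entries lowered by one, and on
    the entry x of the extra cell: the smallest entry other than x, which is 0, or
    1 if x is 0, is the corner, so it is not in the leg; nor is x. *)
Definition hook_admissible S (x : 'I_m.+1) : bool :=
  [&& ord_max \notin S, ord_pred x \notin S & (x == ord0) ==> (x \notin S)].

Lemma mem_legs T c : injective T -> (T c \in legs T) = is_leg c.
Proof.
move=> T_inj; apply/imsetP/idP => [[a _ /T_inj-> //]|].
by case: c => [[a|//]|//] _; exists a.
Qed.

Lemma mem_shifted_legs T i d :
  injective T -> T d = ordS i -> (i \in shifted_legs T) = is_leg d.
Proof. by move=> T_inj Td; rewrite inE -Td mem_legs. Qed.

Lemma card_shifted_legs T : injective T -> #|shifted_legs T| = p.
Proof.
move=> T_inj; rewrite (card_preimset _ (@ordS_inj m.+1)).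
by rewrite card_imset ?card_ord // => a b /T_inj[].
Qed.

Lemma standard_hook (lt : rel cell) T :
  subrel lt_hook lt -> standard lt T -> standard lt_hook T.
Proof.
move=> lt_sub /standardP[T_inj T_surj T_mono]; apply/standardP; split=> // c d cd.
exact/T_mono/lt_sub.
Qed.

Let m_gt0 : 0 < m.
Proof. by rewrite -pq ltn_addl. Qed.

Let corner : cell := arm (Ordinal q_gt0).

Lemma hook_lt_pos T c d : standard lt_hook T -> hook_color c = hook_color d ->
  T c < T d -> hook_pos c < hook_pos d.
Proof.
move=> /standardP[_ _ T_mono] cd Tcd.
have [//|dc|dc] := ltngtP (hook_pos c) (hook_pos d).
  by have := ltn_trans Tcd (T_mono _ _ (hook_chain_lt (esym cd) dc)); rewrite ltnn.
by rewrite (hook_cell_inj cd dc) ltnn in Tcd.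
Qed.

Lemma hook_admissible_standard T :
  standard lt_hook T -> hook_admissible (shifted_legs T) (T None).
Proof.
move=> std_T; have /standardP[T_inj T_surj T_mono] := std_T.
have corner_lt a : T corner < T (leg a) by apply: T_mono.
apply/and3P; split.
- rewrite inE ordS_max; apply/imsetP=> -[a _ e].
  by have := corner_lt a; rewrite -e.
- by rewrite inE ord_predK mem_legs.
- apply/implyP=> /eqP x0; rewrite inE; apply/imsetP=> -[a _ e].
  have := corner_lt a; rewrite -e x0 => c1.
  have : T corner = ord0.
    apply: ord_inj; have [m0|m0] := eqVneq (@ord0 m) ord_max.
      by move: c1; rewrite m0 ordS_max.
    by move: c1; rewrite val_ordS // ltnS leqn0 => /eqP.
  by rewrite -x0 => /T_inj.
Qed.

Lemma hook_filling_unique T T' :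
  standard lt_hook T -> standard lt_hook T' ->
  shifted_legs T = shifted_legs T' -> T None = T' None -> T = T'.
Proof.
move=> std_T std_T' eS eN.
have /standardP[T_inj T_surj T_mono] := std_T.
have /standardP[T'_inj T'_surj T'_mono] := std_T'.
apply: (chain_filling_unique hook_cell_inj T'_inj T_surj T'_surj).
- by move=> c d cd pcd; apply/T_mono/hook_chain_lt.
- by move=> c d cd pcd; apply/T'_mono/hook_chain_lt.
move=> c d Tcd.
have legs_cd : is_leg c = is_leg d.
  rewrite -(mem_shifted_legs (i := ord_pred (T c)) T_inj) ?ord_predK //.
  by rewrite eS (mem_shifted_legs T'_inj (d := d)) ?ord_predK.
case: c d Tcd legs_cd => [c|] [d|] //= => [_ -> //||].
  by rewrite -eN => /T_inj.
by rewrite eN => /T'_inj.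
Qed.

(** The chain filling is standard if its corner is smaller than the leg.  It is enough
    that some entry r of the arm is smaller than the whole leg; r is the smallest
    entry other than x. *)
Lemma hook_filling_exists S x :
  #|S| = p -> hook_admissible S x ->
  exists T, [/\ standard lt_hook T, shifted_legs T = S & T None = x].
Proof.
move=> cS /and3P[maxS pxS x0S].
pose w i := if i == x then None else Some (ord_pred i \in S).
have wx : [set v | w v == None] = [set x].
  by apply/setP=> v; rewrite !inE /w; case: (v == x).
have wleg : [set v | w v == Some true] = @ord_pred m.+1 @^-1: S.
  apply/setP=> v; rewrite !inE /w; case: (v =P x) => [->|_]; first by rewrite (negPf pxS).
  by case: (_ \in S).
have warm : [set v | w v == Some false] = ~: (x |: @ord_pred m.+1 @^-1: S).
  by apply/setP=> v; rewrite !inE /w; case: (v =P x) => //= _; case: (_ \in S).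
have cleg : #|@ord_pred m.+1 @^-1: S| = p.
  by rewrite card_preimset //; apply: can_inj (@ord_predK _).
have carm : #|[set v | w v == Some false]| = q.
  rewrite warm cardsCs setCK cardsU1 inE pxS cleg card_ord; lia.
have [||T [T_inj T_surj T_incr wT]] := chain_filling_exists hook_cell_inj (w := w).
- by rewrite card_option card_sum !card_ord pq.
- by case=> [[a|b]|] /=; rewrite ?wleg ?cleg ?carm ?wx ?cards1.
have TN : T None = x.
  by have := wT None; rewrite /w; case: (T None =P x).
have legE c : (ord_pred (T c) \in S) = is_leg c.
  have := wT c; rewrite /w; case: (T c =P x) => [Tx|_].
    by rewrite Tx (negPf pxS); case: (c).
  by case: c => [c|] //= [].
have [r [rx rS r_min]] : exists r : 'I_m.+1,
    [/\ r != x, ord_pred r \notin S & forall s, s \in S -> r < ordS s].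
  have S_max s : s \in S -> s != ord_max by apply: contraTneq => ->.
  have [x0|x0] := eqVneq x ord0.
    exists (ordS x); rewrite ordSK; split.
    - by rewrite ordS_eq eq_sym ord_pred_neq ?m_gt0.
    - by rewrite x0 eqxx /= -x0 in x0S.
    move=> s sS; rewrite (val_ordS (S_max s sS)) x0 ltnS.
    rewrite val_ordS; last by rewrite -val_eqE /= eq_sym -lt0n.
    rewrite lt0n; apply: contraTneq sS => s0.
    have -> : s = x by apply: ord_inj; rewrite s0 x0.
    by rewrite (implyP x0S) // x0.
  exists ord0; rewrite ord_pred0 eq_sym x0 maxS; split=> // s sS.
  by rewrite val_ordS ?S_max.
have [c Tc] := T_surj r.
have : w (T c) = Some false by rewrite Tc /w (negPf rx) (negPf rS).
rewrite wT; case: c Tc => // -[//|b] /= Tb _.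
exists T; split=> //; last first.
  by apply/setP=> i; have [c ci] := T_surj (ordS i);
     rewrite inE -ci mem_legs // -legE ci ordSK.
apply/standardP; split=> // -[[a1|b1]|] [[a2|b2]|] //=; try by move=> lt12; apply: T_incr.
move=> /eqP b10.
have leb : T (arm b1) <= T (arm b).
  have [b_gt0|bb|/ord_inj-> //] := ltngtP b1 b; last by rewrite b10 in bb.
  by apply: ltnW; apply: T_incr.
apply: leq_ltn_trans leb _; rewrite Tb -[T (leg a2)]ord_predK r_min // legE.
Qed.

(** The counting scheme for all three positions of the extra cell: a standard
    filling with lowered leg set S and extra entry x has cyclic descent set [F S x],
    and [G J x] recovers S from it.  So the fiber of J is in bijection with the
    possible values [P J] of x. *)
Lemma hook_distribution (lt above : rel cell)
    (adm : {set 'I_m.+1} -> 'I_m.+1 -> bool)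
    (F G : {set 'I_m.+1} -> 'I_m.+1 -> {set 'I_m.+1})
    (P : {set 'I_m.+1} -> {set 'I_m.+1}) :
  subrel lt_hook lt ->
  (forall T, standard lt T -> adm (shifted_legs T) (T None)) ->
  (forall S x, #|S| = p -> adm S x ->
     exists T, [/\ standard lt T, shifted_legs T = S & T None = x]) ->
  (forall T c d, standard lt T -> T c != ord_max -> T d = ordS (T c) ->
     above c d = (T c \in F (shifted_legs T) (T None))) ->
  (forall S x, adm S x ->
     [/\ #|F S x| = #|S|.+1, x \in P (F S x) & G (F S x) x = S]) ->
  (forall J x, x \in P J -> adm (G J x) x /\ F (G J x) x = J) ->
  cyclic_distribution lt above (n := m.+1) p.+1 (fun J => #|P J|).
Proof.
move=> lt_sub std_adm adm_std aboveE FP PG.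
have cdescE T : standard lt T ->
    cyclic_descents above p.+1 T = F (shifted_legs T) (T None).
  move=> std_T; have /standardP[T_inj T_surj _] := std_T.
  apply: cyclic_descentsE => //.
    by have [-> _ _] := FP _ _ (std_adm T std_T); rewrite card_shifted_legs.
  apply/setP=> i; rewrite in_setD1.
  have [->|i_max /=] := eqVneq i ord_max; first exact/negbTE/max_descents.
  have [c ci] := T_surj i; have [d di] := T_surj (ordS i).
  have c_max : T c != ord_max by rewrite ci.
  have Tdc : T d = ordS (T c) by rewrite ci.
  by rewrite -ci (mem_descents _ T_inj c_max Tdc) (aboveE T).
split=> [T std_T|J cJ].
  have /standardP[T_inj _ _] := std_T.
  by rewrite cdescE //; have [-> _ _] := FP _ _ (std_adm T std_T);
     rewrite card_shifted_legs.
rewrite -(card_in_imset (f := fun T => T None) (D := cyclic_fiber lt above p.+1 J)).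
  congr #|pred_of_set _|; apply/setP=> x; apply/imsetP/idP => [[T]|xP].
    rewrite inE => /andP[std_T /eqP <-] ->; rewrite cdescE //.
    by have [] := FP _ _ (std_adm T std_T).
  have [adm_x FG] := PG _ _ xP; have [cF _ _] := FP _ _ adm_x.
  have cG : #|G J x| = p by apply: succn_inj; rewrite -cF FG.
  have [T [std_T ST Tx]] := adm_std _ _ cG adm_x.
  by exists T => //; rewrite inE std_T cdescE // ST Tx FG /=.
move=> T T'; rewrite !inE => /andP[std_T /eqP cT] /andP[std_T' /eqP cT'] eN.
apply: hook_filling_unique => //.
- exact: standard_hook std_T.
- exact: standard_hook std_T'.
rewrite cdescE // in cT; rewrite cdescE // in cT'.
have [_ _ <-] := FP _ _ (std_adm T std_T).
have [_ _ <-] := FP _ _ (std_adm T' std_T').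
by rewrite cT cT' eN.
Qed.

(** ** The extra cell northeast of the hook *)

Definition above_extra_ne (c d : cell) : bool :=
  match c, d with
  | leg a, leg b => a < b
  | arm _, leg _ => true
  | None, Some _ => true
  | _, _ => false
  end.

(** All other cells are below the extra cell, so x is a descent unless it is last. *)
Definition cdes_ne S (x : 'I_m.+1) := (if x \in S then ord_max else x) |: S.

(** The entry x is always a start of J: x - 1 is not in S because x is not in the
    leg. *)
Lemma hook_ne_distribution :
  cyclic_distribution lt_hook above_extra_ne (n := m.+1) p.+1
    (fun J => #|starts J|).
Proof.
pose G J (x : 'I_m.+1) := J :\ (if ord_max \in J then ord_max else x).
apply: (@hook_distribution _ _ hook_admissible cdes_ne G) => //.
- exact: hook_admissible_standard.
- exact: hook_filling_exists.
- move=> T c d std_T c_max Tdc; have /standardP[T_inj T_surj T_mono] := std_T.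
  have cS := mem_shifted_legs T_inj Tdc.
  rewrite /cdes_ne in_setU1 cS.
  have -> : (T c == (if T None \in shifted_legs T then ord_max else T None))
          = (c == None) && ~~ is_leg d.
    case: ifP => NS.
      rewrite (negPf c_max); apply/esym/negbTE/negP=> /andP[/eqP cN].
      by rewrite -cS cN NS.
    by rewrite (inj_eq T_inj); case: eqP => //= cN; rewrite -cS cN NS.
  have ltT : T c < T d by rewrite Tdc val_ordS.
  case: c d {cS Tdc c_max} ltT => [[a|a]|] [[b|b]|] //= ltT; last by rewrite ltnn in ltT.
  exact: (hook_lt_pos std_T (c := leg a) (d := leg b) erefl ltT).
- move=> S x /and3P[maxS pxS /implyP x0S]; split.
  + by rewrite /cdes_ne cardsU1; case: ifPn => [xS|->]; rewrite ?maxS.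
  + rewrite in_starts /cdes_ne; apply/andP; split.
      by rewrite in_setU1; case: ifPn; rewrite ?eqxx ?orbT.
    rewrite in_setU1 negb_or pxS andbT; case: ifPn => [xS|_].
      apply: contraTneq xS => /esym px_max; apply: x0S.
      by rewrite -(ord_predK x) -px_max ordS_max.
    exact: ord_pred_neq.
  + rewrite /G /cdes_ne in_setU1 (negPf maxS) orbF.
    case: ifPn => [xS|xS]; first by rewrite eqxx setU1K.
    by case: eqP => [->|_]; rewrite setU1K.
- move=> J x; rewrite in_starts => /andP[xJ pxJ]; rewrite /G; split.
    apply/and3P; split.
    + by rewrite in_setD1; case: ifPn; rewrite ?eqxx ?andbF.
    + by rewrite in_setD1 (negPf pxJ) andbF.
    + apply/implyP=> /eqP x0; rewrite x0 ord_pred0 in pxJ.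
      by rewrite (negPf pxJ) in_setD1 eqxx.
  rewrite /cdes_ne; have [maxJ|maxJ] := boolP (ord_max \in J); rewrite !in_setD1 ?eqxx /=.
    by rewrite xJ andbT; case: eqP => [->|_] /=; rewrite setD1K.
  by rewrite setD1K.
Qed.

(** ** The extra cell southwest of the hook *)

Definition above_extra_sw (c d : cell) : bool :=
  match c, d with
  | leg a, leg b => a < b
  | arm _, leg _ => true
  | Some _, None => true
  | _, _ => false
  end.

(** All other cells are above the extra cell, so x - 1 is a descent unless x is the
    smallest entry, and x is never a descent, even if x + 1 is in the leg. *)
Definition cdes_sw S (x : 'I_m.+1) :=
  ord_pred x |: (if x \in S then ord_max |: (S :\ x) else S).

(** Here x - 1 belongs to J and x does not, so x ranges over the starts of the
    complement of J. *)
Lemma hook_sw_distribution :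
  cyclic_distribution lt_hook above_extra_sw (n := m.+1) p.+1
    (fun J => #|starts J|).
Proof.
pose G J (x : 'I_m.+1) :=
  if (ord_max \in J) && (x != ord0) then x |: (J :\ ord_max :\ ord_pred x)
  else J :\ ord_pred x.
suff [cd cf] : cyclic_distribution lt_hook above_extra_sw (n := m.+1) p.+1
    (fun J => #|starts (~: J)|).
  by split=> // J /cf->; rewrite card_starts_compl.
apply: (@hook_distribution _ _ hook_admissible cdes_sw G (fun J => starts (~: J))) => //.
- exact: hook_admissible_standard.
- exact: hook_filling_exists.
- move=> T c d std_T c_max Tdc; have /standardP[T_inj T_surj T_mono] := std_T.
  have cS := mem_shifted_legs T_inj Tdc.
  rewrite /cdes_sw in_setU1.
  have -> : (T c == ord_pred (T None)) = (d == None).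
    by rewrite -ordS_eq -Tdc (inj_eq T_inj).
  have -> : (T c \in (if T None \in shifted_legs T
               then ord_max |: (shifted_legs T :\ T None) else shifted_legs T))
          = is_leg d && (c != None).
    case: ifPn => NS; last first.
      by rewrite cS andb_idr // -cS; apply: contraTneq => ->.
    by rewrite in_setU1 in_setD1 (negPf c_max) cS (inj_eq T_inj) andbC.
  have ltT : T c < T d by rewrite Tdc val_ordS.
  case: c d {cS Tdc c_max} ltT => [[a|a]|] [[b|b]|] //= ltT; last by rewrite ltnn in ltT.
  exact: (hook_lt_pos std_T (c := leg a) (d := leg b) erefl ltT).
- move=> S x /and3P[maxS pxS /implyP x0S].
  have x_neq0 : x \in S -> x != ord0 by apply: contraTneq => x0; rewrite x0S // x0.
  have px_max : (ord_pred x == ord_max) = (x == ord0).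
    by rewrite -ordS_max -(inj_eq (@ordS_inj m.+1)) ord_predK.
  have px_x : ord_pred x != x by exact: ord_pred_neq.
  have x_max : x \in S -> x != ord_max by apply: contraTneq => ->.
  split.
  + rewrite /cdes_sw cardsU1; case: ifPn => xS; last by rewrite pxS.
    rewrite in_setU1 px_max (negPf (x_neq0 xS)) in_setD1 (negPf pxS) andbF /=.
    by rewrite cardsU1 in_setD1 (negPf maxS) andbF /= (cardsD1 x S) xS.
  + rewrite in_starts !in_setC negbK /cdes_sw !in_setU1 eqxx andbT negb_or.
    rewrite eq_sym px_x /=; case: ifPn => // xS.
    by rewrite in_setU1 in_setD1 eqxx orbF x_max.
  + rewrite /G /cdes_sw; have [xS|xS] := boolP (x \in S).
      rewrite !in_setU1 eqxx orbT x_neq0 //=.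
      rewrite setUCA setU1K; last first.
        by rewrite in_setU1 negb_or eq_sym px_max x_neq0 // in_setD1 (negPf maxS) andbF.
      by rewrite setU1K ?setD1K // in_setD1 (negPf pxS) andbF.
    rewrite in_setU1 (negPf maxS) orbF eq_sym px_max andbN.
    by rewrite setU1K.
- move=> J x; rewrite in_starts !in_setC negbK => /andP[xJ pxJ].
  have px_x : ord_pred x != x by exact: ord_pred_neq.
  have px_max : (ord_pred x == ord_max) = (x == ord0).
    by rewrite -ordS_max -(inj_eq (@ordS_inj m.+1)) ord_predK.
  rewrite /G; case: ifPn => [/andP[maxJ x0]|nmax].
    have x_max : x != ord_max by apply: contraNneq xJ => ->.
    split.
      apply/and3P; split.
      + by rewrite in_setU1 !in_setD1 eqxx andbF orbF eq_sym.
      + by rewrite in_setU1 in_setD1 eqxx orbF.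
      + by rewrite (negPf x0).
    rewrite /cdes_sw setU11 setU1K; last by rewrite !in_setD1 (negPf xJ) !andbF.
    rewrite setUCA setD1K ?setD1K // in_setD1 px_max x0 //.
  split.
    apply/and3P; split.
    + rewrite in_setD1 eq_sym px_max; move: nmax; rewrite negb_and negbK.
      by case/orP=> [/negPf->|->]; rewrite ?andbF.
    + by rewrite in_setD1 eqxx.
    + by apply/implyP=> _; rewrite in_setD1 (negPf xJ) andbF.
  by rewrite /cdes_sw in_setD1 (negPf xJ) andbF setD1K.
Qed.

(** ** The extra cell inside the hook *)

Definition lt_inner (c d : cell) : bool :=
  lt_hook c d ||
  match c, d with
  | leg a, None => a == 0 :> nat
  | arm b, None => b == 1 :> nat
  | _, _ => false
  end.

Definition above_inner (c d : cell) : bool :=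
  match c, d with
  | leg a, leg b => a < b
  | arm _, leg _ => true
  | None, leg b => 0 < b
  | arm _, None => true
  | _, _ => false
  end.

(** The inner cell needs a smaller entry in the leg, which is an element of S below
    x - 1, and two smaller entries in the arm.  One of these is the corner, which
    is 0; the other one, lowered by one, is a non-element of S below x - 1. *)
Definition inner_admissible S (x : 'I_m.+1) : bool :=
  [&& hook_admissible S x, x != ord0, [exists s in S, s < ord_pred x]
    & [exists s, (s \notin S) && (s < ord_pred x)]].

(** The inner cell is below x - 1 exactly if x - 1 is in the arm.  If it is in the
    leg, then x - 1 is no descent and one descent is missing, so the last entry
    takes its place. *)
Definition cdes_inner S (x : 'I_m.+1) :=
  (if ord_pred (ord_pred x) \in S then ord_max else ord_pred x) |: S.

(** The starts of J other than its smallest element. *)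
Definition late_starts J : {set 'I_m.+1} :=
  [set y in starts J | [exists s in J, s < y]].

(** If J misses the last entry then its smallest element is a start, also when it
    is 0. *)
Lemma card_late_starts J :
  ord_max \notin J -> J != set0 -> #|late_starts J| = #|starts J| - 1.
Proof.
move=> maxJ /set0Pn[y0 y0J].
pose y := [arg min_(i < y0 in J) (i : nat)].
have [yJ y_min] : y \in J /\ forall s, s \in J -> y <= s.
  by rewrite /y; case: arg_minnP.
have yS : y \in starts J.
  rewrite in_starts yJ; have [->|/val_ord_pred py] := eqVneq y ord0.
    by rewrite ord_pred0.
  by apply/negP=> /y_min; rewrite -py ltnn.
rewrite (cardsD1 y (starts J)) yS addKn; apply: eq_card => i.
rewrite in_setD1 [LHS]in_set andbC; case: (boolP (i \in starts J)) => [iS|_]; last first.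
  by rewrite !andbF.
rewrite !andbT; apply/existsP/idP => [[s /andP[sJ si]]|iy].
  by apply: contraTneq si => ->; rewrite -leqNgt y_min.
exists y; rewrite yJ /= ltn_neqAle eq_sym iy y_min //.
by move: iS; rewrite in_starts => /andP[].
Qed.

Lemma inner_admissible_standard T : 0 < p -> 1 < q ->
  standard lt_inner T -> inner_admissible (shifted_legs T) (T None).
Proof.
move=> p_gt0 q_gt1 std_T.
have std_h : standard lt_hook T.
  by apply: (standard_hook _ std_T) => c d cd; rewrite /lt_inner cd.
have /standardP[T_inj T_surj T_mono] := std_T.
have leg_lt : T (leg (Ordinal p_gt0)) < T None by apply: T_mono; rewrite /lt_inner orbT.
have arm_lt : T (arm (Ordinal q_gt1)) < T None by apply: T_mono; rewrite /lt_inner orbT.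
have x0 : T None != ord0 by apply: contraTneq leg_lt => ->.
have leg0 : T (leg (Ordinal p_gt0)) != ord0.
  apply: contraTneq (T_mono corner (leg (Ordinal p_gt0)) isT) => ->.
  by rewrite ltn0.
have arm0 : T (arm (Ordinal q_gt1)) != ord0.
  apply: contraTneq (T_mono corner (arm (Ordinal q_gt1)) isT) => ->.
  by rewrite ltn0.
apply/and4P; split=> //; first exact: hook_admissible_standard.
  apply/existsP; exists (ord_pred (T (leg (Ordinal p_gt0)))).
  rewrite (mem_shifted_legs T_inj (d := leg (Ordinal p_gt0))) ?ord_predK //=.
  by rewrite -ltnS !val_ord_pred.
apply/existsP; exists (ord_pred (T (arm (Ordinal q_gt1)))).
rewrite (mem_shifted_legs T_inj (d := arm (Ordinal q_gt1))) ?ord_predK //=.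
by rewrite -ltnS !val_ord_pred.
Qed.

(** For the arm: the corner has entry 0, so the arm entry r + 1, which is smaller
    than x, sits at position 1 or later, and the cell at position 1 is smaller
    than x as well. *)
Lemma inner_filling_exists S x : #|S| = p -> inner_admissible S x ->
  exists T, [/\ standard lt_inner T, shifted_legs T = S & T None = x].
Proof.
move=> cS /and4P[adm_x x0 /existsP[l /andP[lS ly]] /existsP[r /andP[rS ry]]].
have [T [std_T ST Tx]] := hook_filling_exists cS adm_x.
exists T; split=> //; have /standardP[T_inj T_surj T_mono] := std_T.
have lt_x (s : 'I_m.+1) : s < ord_pred x -> ordS s = s.+1 :> nat /\ ordS s < x.
  move=> sy; have s_max : s != ord_max.
    by apply: contraTneq sy => ->; rewrite -leqNgt -ltnS.
  by rewrite val_ordS // -(val_ord_pred x0).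
have [lS1 lx] := lt_x l ly; have [rS1 rx] := lt_x r ry.
have leg_lt (a : 'I_p) : a = 0 :> nat -> T (leg a) < T None.
  move=> a0; have [c cl] := T_surj (ordS l).
  have := mem_shifted_legs T_inj cl; rewrite ST lS.
  case: c cl => [[a'|//]|//] cl _; rewrite Tx; apply: leq_ltn_trans lx; rewrite -cl.
  have [aa'|a'a|/ord_inj-> //] := ltngtP a a'; last by rewrite a0 in a'a.
  by apply: ltnW; apply: T_mono.
have arm_lt (b : 'I_q) : b = 1 :> nat -> T (arm b) < T None.
  move=> b1; have [c cr] := T_surj (ordS r).
  have := mem_shifted_legs T_inj cr; rewrite ST (negPf rS).
  case: c cr => [[//|b']|] cr _; last by move: rx; rewrite -Tx cr ltnn.
  rewrite Tx; apply: leq_ltn_trans rx; rewrite -cr.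
  have [bb'|b'b|/ord_inj-> //] := ltngtP b b'; first by apply: ltnW; apply: T_mono.
  have b'0 : b' = 0 :> nat by move: b'b; rewrite b1 ltnS leqn0 => /eqP.
  have [d d0] := T_surj ord0; have T_b' : 0 < T (arm b') by rewrite cr rS1.
  have [e|lt_d|eN] : [\/ d = arm b', lt_hook (arm b') d | d = None].
  - case: d {d0} => [[a|b'']|]; last by constructor 3.
      by constructor 2; rewrite /= b'0.
    have [b'b''|//|/ord_inj->] := ltngtP b' b''; last by constructor 1.
      by constructor 2.
    by rewrite b'0.
  - by rewrite -e d0 in T_b'.
  - by have := T_mono _ _ lt_d; rewrite d0.
  - by rewrite -Tx -eN d0 eqxx in x0.
apply/standardP; split=> // c d /orP[/T_mono //|].
by case: c d => [[a|b]|] [[a'|b']|] //= /eqP; [apply: leg_lt|apply: arm_lt].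
Qed.

(** Let y = x - 1.  If the last entry is not in J then y is in J and y - 1 is not; if
    it is in J then y - 1 is in J and y is not.  In both cases y is a start of the set
    M among J and its complement that misses the last entry.  Of the two smaller
    entries demanded by admissibility, one corresponds to y - 1; the other one says
    that M has an element smaller than y. *)
Lemma hook_inner_distribution : 0 < p -> 1 < q ->
  cyclic_distribution lt_inner above_inner (n := m.+1) p.+1
    (fun J => #|starts J| - 1).
Proof.
move=> p_gt0 q_gt1.
pose M J : {set 'I_m.+1} := if ord_max \in J then ~: J else J.
pose P J : {set 'I_m.+1} := @ord_pred m.+1 @^-1: late_starts (M J).
pose G J (x : 'I_m.+1) := J :\ (if ord_max \in J then ord_max else ord_pred x).
have maxM J : ord_max \notin M J.
  by rewrite /M; case: ifPn => // maxJ; rewrite in_setC maxJ.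
suff [cd cf] : cyclic_distribution lt_inner above_inner (n := m.+1) p.+1
    (fun J => #|P J|).
  split=> // J cJ; rewrite cf //.
  rewrite (card_preimset _ (can_inj (@ord_predK m.+1))) card_late_starts //.
    by rewrite /M; case: ifP => // _; rewrite card_starts_compl.
  have J0 : J != set0 by rewrite -card_gt0 cJ.
  rewrite /M; case: ifPn => // _; rewrite -card_gt0 cardsCs setCK cJ card_ord; lia.
apply: (@hook_distribution _ _ inner_admissible cdes_inner G P).
- by move=> c d cd; rewrite /lt_inner cd.
- by move=> T; apply: inner_admissible_standard.
- exact: inner_filling_exists.
- move=> T c d std_T c_max Tdc; have /standardP[T_inj T_surj T_mono] := std_T.
  have std_h : standard lt_hook T.
    by apply: (standard_hook _ std_T) => c' d' cd; rewrite /lt_inner cd.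
  have cS := mem_shifted_legs T_inj Tdc.
  rewrite /cdes_inner in_setU1 cS.
  have eN : (T c == ord_pred (T None)) = (d == None).
    by rewrite -ordS_eq -Tdc (inj_eq T_inj).
  have -> : (T c == (if ord_pred (ord_pred (T None)) \in shifted_legs T
                     then ord_max else ord_pred (T None)))
          = (d == None) && ~~ is_leg c.
    have [/eqP dN|dN] := boolP (d == None).
      have -> : ord_pred (T None) = T c by apply/eqP; rewrite eq_sym eN dN.
      rewrite (mem_shifted_legs T_inj (d := c)) ?ord_predK //.
      by case: (is_leg c); rewrite ?eqxx ?(negPf c_max).
    by case: ifP => _; rewrite ?(negPf c_max) ?eN ?(negPf dN).
  have ltT : T c < T d by rewrite Tdc val_ordS.
  case: c d {cS Tdc c_max eN} ltT => [[a|a]|] [[b|b]|] //= ltT; last by rewrite ltnn in ltT.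
    exact: (hook_lt_pos std_h (c := leg a) (d := leg b) erefl ltT).
  rewrite lt0n; apply: contraTneq ltT => b0.
  by rewrite -leqNgt ltnW // T_mono // /lt_inner /= b0.
- move=> S x /and4P[/and3P[maxS pxS _] x0 /existsP[l /andP[lS ly]] /existsP[r /andP[rS ry]]].
  have px_max : ord_pred x != ord_max.
    by apply: contraNneq x0 => e; rewrite -(ord_predK x) e ordS_max.
  have lt_max (s : 'I_m.+1) : s < ord_pred x -> s != ord_max.
    by move=> sy; apply: contraTneq sy => ->; rewrite -leqNgt -ltnS.
  split.
  + by rewrite /cdes_inner cardsU1; case: ifPn; rewrite ?maxS ?pxS.
  + rewrite inE /late_starts inE in_starts /M /cdes_inner !in_setU1 (negPf maxS) orbF.
    have [ppS|ppS] := boolP (ord_pred (ord_pred x) \in S).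
      rewrite eqxx !in_setC !in_setU1 (negPf px_max) pxS ppS orbT /=.
      by apply/existsP; exists r; rewrite in_setC in_setU1 negb_or lt_max ?rS.
    rewrite eq_sym (negPf px_max) !in_setU1 eqxx (negPf ppS) orbF ord_pred_neq //=.
    by apply/existsP; exists l; rewrite in_setU1 lS orbT.
  + rewrite /G /cdes_inner in_setU1 (negPf maxS) orbF.
    case: (ord_pred (ord_pred x) \in S); first by rewrite eqxx setU1K.
    by rewrite eq_sym (negPf px_max) setU1K.
- move=> J x; rewrite inE /late_starts inE in_starts.
  move=> /andP[/andP[yM pyM] /existsP[s /andP[sM sy]]].
  have y0 : ord_pred x != ord0 by apply: contraTneq sy => ->.
  have py_lt : ord_pred (ord_pred x) < ord_pred x by rewrite -(val_ord_pred y0).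
  have lt_max (i : 'I_m.+1) : i < ord_pred x -> i != ord_max.
    by move=> iy; apply: contraTneq iy => ->; rewrite -leqNgt -ltnS.
  have lt_neq (i : 'I_m.+1) : i < ord_pred x -> i != ord_pred x.
    by move=> iy; apply: contraTneq iy => ->; rewrite ltnn.
  have y_max : ord_pred x != ord_max by apply: contraTneq yM => ->.
  have x0 : x != ord0 by apply: contraNneq y_max => ->; rewrite ord_pred0.
  rewrite /G /inner_admissible /hook_admissible /cdes_inner (negPf x0) /= andbT.
  move: yM pyM sM; rewrite /M; have [maxJ|maxJ] := boolP (ord_max \in J).
    rewrite !in_setC negbK !in_setD1 eqxx => yJ pyJ sJ.
    rewrite pyJ (negPf yJ) !andbF lt_max //= setD1K //; split=> //.
    apply/andP; split; apply/existsP.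
      by exists (ord_pred (ord_pred x)); rewrite in_setD1 pyJ lt_max.
    by exists s; rewrite in_setD1 (negPf sJ) andbF.
  rewrite !in_setD1 eqxx => yJ pyJ sJ.
  rewrite (negPf pyJ) (negPf maxJ) !andbF /= setD1K //; split=> //.
  apply/andP; split; apply/existsP.
    by exists s; rewrite in_setD1 sJ lt_neq.
  by exists (ord_pred (ord_pred x)); rewrite in_setD1 (negPf pyJ) andbF.
Qed.

End Hook.

(** * Near-hooks as diagrams *)

Definition cell_before (x y : nat * nat) : bool :=
  ((x.1 == y.1) && (x.2 < y.2)) || ((x.2 == y.2) && (x.1 < y.1)).

Definition diagram_distribution (D : diagram) (n k : nat) :
    ({set 'I_n} -> nat) -> Prop :=
  cyclic_distribution (fun x y : D => cell_before (val x) (val y))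
    (fun x y : D => (val x).1 < (val y).1) k.

Lemma in_SYT n (D : diagram) (T : {ffun D -> 'I_n}) :
  (T \in SYT n D) = standard (fun x y : D => cell_before (val x) (val y)) T.
Proof.
rewrite inE /is_syt /standard; congr [&& _, _ & _].
apply/andP/forallP => [[/forallP rows /forallP cols] x|lt_T].
  apply/forallP=> y; apply/implyP=> /orP[].
    exact/implyP/(forallP (rows x)).
  exact/implyP/(forallP (cols x)).
by split; apply/forallP=> x; apply/forallP=> y; apply/implyP=> xy;
  apply: (implyP (forallP (lt_T x) y)); rewrite /cell_before xy ?orbT.
Qed.

Lemma diagram_distributionE n k D (N : {set 'I_n} -> nat) :
  diagram_distribution D k N ->
  (forall T : {ffun D -> 'I_n}, T \in SYT n D -> #|cDes k T| = k) /\
  (forall J : {set 'I_n}, #|J| = k -> #|cDes_fiber D k J| = N J).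
Proof.
move=> [card_cdes card_fiber]; split=> [T|J cJ].
  by rewrite in_SYT => /card_cdes.
rewrite -card_fiber //; apply: eq_card => T.
by rewrite [LHS]inE in_SYT [RHS]inE.
Qed.

(** Inserting empty rows and columns preserves all comparisons of rows and
    columns, so a model of the cells of E is a model of D. *)
Lemma shape_distribution (X : finType) (coord : X -> nat * nat) (lt above : rel X)
    (D E : diagram) n k (N : {set 'I_n} -> nat) :
  injective coord ->
  (forall c, c \in E <-> exists x, coord x = c) ->
  (forall x y, cell_before (coord x) (coord y) = lt x y) ->
  (forall x y, ((coord x).1 < (coord y).1) = above x y) ->
  has_shape D E ->
  cyclic_distribution lt above (n := n) k N -> diagram_distribution D k N.
Proof.
move=> coord_inj memE ltE aboveE [f [g [f_homo g_homo defD]]].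
have f_eq : {mono f : i j / i == j}.
  by move=> i j; rewrite !eqn_leq !(leq_mono f_homo).
have g_eq : {mono g : i j / i == j}.
  by move=> i j; rewrite !eqn_leq !(leq_mono g_homo).
have f_lt : {mono f : i j / i < j} := leqW_mono (leq_mono f_homo).
have g_lt : {mono g : i j / i < j} := leqW_mono (leq_mono g_homo).
pose place (c : nat * nat) := (f c.1, g c.2).
have memD x : place (coord x) \in D.
  by rewrite defD; apply/imfsetP; exists (coord x) => //=; apply/memE; exists x.
apply: (@cyclic_distribution_iso _ _ _ _ _ _ (fun x => [` memD x])).
- move=> x y /(congr1 val) /= [/eqP fxy /eqP gxy]; apply: coord_inj.
  rewrite f_eq in fxy; rewrite g_eq in gxy.
  by rewrite [coord x]surjective_pairing (eqP fxy) (eqP gxy) -surjective_pairing.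
- move=> [y yD]; have := yD; rewrite {1}defD => /imfsetP[c /= /memE[x xc] yc].
  by exists x; apply: val_inj; rewrite /= /place xc.
- by move=> x y; rewrite -ltE /cell_before /= !f_eq !g_eq !f_lt !g_lt.
- by move=> x y; rewrite -aboveE /= f_lt.
Qed.

Lemma lt_height (D : diagram) x : x \in D -> x.1 < height D.
Proof. by move=> xD; apply: (leq_bigmax_seq (F := fun x : nat * nat => x.1.+1)). Qed.

Lemma lt_width (D : diagram) x : x \in D -> x.2 < width D.
Proof. by move=> xD; apply: (leq_bigmax_seq (F := fun x : nat * nat => x.2.+1)). Qed.

Lemma cell_before_rot u v (x y : nat * nat) :
  x.1 < u -> x.2 < v -> y.1 < u -> y.2 < v ->
  cell_before (u - y.1.+1, v - y.2.+1) (u - x.1.+1, v - x.2.+1) = cell_before x y.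
Proof. by rewrite /cell_before /=; lia. Qed.

(** The half turn reverses the order of cells and of rows. *)
Lemma reverse_distribution m (D : diagram) k (N : {set 'I_m.+1} -> nat) :
  (forall J : {set 'I_m.+1}, N (@cyc_neg m @^-1: J) = N J) ->
  diagram_distribution (reverse D) k N -> diagram_distribution D k N.
Proof.
move=> N_neg /(cyclic_distribution_rev N_neg).
pose rot (x : nat * nat) := (height D - x.1.+1, width D - x.2.+1).
have rotK x : x \in D -> rot (rot x) = x.
  case: x => i j xD; have := lt_height xD; have := lt_width xD; rewrite /rot /=.
  by move=> jD iD; congr (_, _); lia.
have memD (x : reverse D) : rot (val x) \in D.
  by case: x => x xR /=; have /imfsetP[y /= yD ->] := xR; rewrite rotK.
have rotE (x : reverse D) : exists2 y, y \in D & val x = rot y.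
  by case: x => x /= /imfsetP[y /= yD ->]; exists y.
apply: (@cyclic_distribution_iso _ _ _ _ _ _ (fun x => [` memD x])).
- move=> x y /(congr1 val) /=; have [a aD xa] := rotE x; have [b bD yb] := rotE y.
  by rewrite xa yb !rotK // => ab; apply: val_inj; rewrite /= xa yb ab.
- move=> [y yD]; have ryR : rot y \in reverse D by apply/imfsetP; exists y.
  by exists [` ryR]; apply: val_inj; rewrite /= rotK.
- move=> x y /=; have [a aD ->] := rotE x; have [b bD ->] := rotE y.
  by rewrite !rotK // cell_before_rot ?lt_height ?lt_width.
- move=> x y /=; have [a aD ->] := rotE x; have [b bD ->] := rotE y.
  rewrite /rot /=; have := lt_height aD; have := lt_height bD; lia.
Qed.

Lemma in_dsum (D1 D2 : diagram) c :
  c \in dsum D1 D2 <->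
  (exists2 x, x \in D1 & (x.1 + height D2, x.2) = c) \/
  (exists2 x, x \in D2 & (x.1, x.2 + width D1) = c).
Proof.
rewrite in_fsetU; split.
  by case/orP=> /imfsetP[x /= xD ->]; [left|right]; exists x.
by case=> -[x xD <-]; apply/orP; [left|right]; apply/imfsetP; exists x.
Qed.

Lemma in_straight lam c : (c \in straight lam) = (c.2 < nth 0 lam c.1).
Proof. by rewrite in_skew nth_nil. Qed.

Section Shapes.
Variables (m k : nat) (D : diagram).

Lemma near_hook_a_distribution :
  near_hook_a m.+1 k D -> diagram_distribution (n := m.+1) D k (fun=> 1).
Proof.
move=> [k_bnd shD]; have [q qE] : exists q, q = m.+1 - k by exists (m.+1 - k).
have kq : k + q = m.+1 by lia.
have k_gt0 : 0 < k by lia.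
rewrite -qE in shD; set D1 := straight (nseq k 1) in shD; set D2 := straight [:: q] in shD.
have H : 0 < height D2 by apply: (@lt_height D2 (0, 0)); rewrite in_straight /=; lia.
have W : 0 < width D1.
  by apply: (@lt_width D1 (0, 0)); rewrite in_straight nth_nseq k_gt0.
pose coord (x : 'I_k + 'I_q) : nat * nat :=
  match x with inl a => (a + height D2, 0) | inr b => (0, b + width D1) end.
apply: (shape_distribution (coord := coord) _ _ _ _ shD (column_row_distribution kq k_gt0)).
- move=> [a|b] [a'|b'] //= [] => [/addIn/ord_inj-> //|||/addIn/ord_inj-> //]; lia.
- move=> c; rewrite in_dsum; split.
    case=> -[[i j]]; rewrite in_straight /=.
      rewrite nth_nseq; case: ifP => // ik j0 <-; exists (inl (Ordinal ik)).
      by congr (_, _); lia.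
    case: i => [jq|i]; last by rewrite /= nth_nil.
    by move=> <-; exists (inr (Ordinal jq)).
  move=> [[a|b] <-]; [left; exists (val a, 0)|right; exists (0, nat_of_ord b)] => //.
    by rewrite in_straight nth_nseq ltn_ord.
  by rewrite in_straight /=.
- move=> [a|b] [a'|b'] /=; rewrite /cell_before /=; lia.
- move=> [a|b] [a'|b'] /=; lia.
Qed.

Lemma near_hook_b_distribution :
  near_hook_b m.+1 k D ->
  diagram_distribution (n := m.+1) D k (fun J => #|starts J|).
Proof.
move=> [k_bnd shD]; have [q qE] : exists q, q = m.+1 - k by exists (m.+1 - k).
have [p pE] : exists p, p = k - 1 by exists (k - 1).
have pq : p + q = m by lia.
have q_gt0 : 0 < q by lia.
have -> : k = p.+1 by lia.
rewrite -qE -pE in shD; set D1 := straight (q :: nseq p 1) in shD.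
set D2 := straight [:: 1] in shD.
have memD1 (c : nat * nat) :
    c \in D1 <-> (c.1 = 0 /\ c.2 < q) \/ (0 < c.1 <= p /\ c.2 = 0).
  rewrite in_straight; case: c => [[|i] j] /=; first by lia.
  by rewrite nth_nseq; case: ifP; lia.
have memD2 (c : nat * nat) : c \in D2 <-> c = (0, 0).
  rewrite in_straight; case: c => [[|i] j] /=; last by rewrite nth_nil.
  by split=> [|[->] //]; case: j.
have armD1 b : b < q -> (0, b) \in D1 by move=> bq; apply/memD1; left.
have legD1 a : a < p -> (a.+1, 0) \in D1 by move=> ap; apply/memD1; right.
have cornerD2 : (0, 0) \in D2 by apply/memD2.
have H1 : 0 < height D1 := lt_height (armD1 _ q_gt0).
have H2 : 0 < height D2 := lt_height cornerD2.
have W2 : 0 < width D2 := lt_width cornerD2.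
have legH (a : 'I_p) : a.+1 < height D1 := lt_height (legD1 _ (ltn_ord a)).
have W1 : 0 < width D1 := lt_width (armD1 _ q_gt0).
have armW (b : 'I_q) : b < width D1 := lt_width (armD1 _ (ltn_ord b)).
case: shD => shD.
  pose coord (x : option ('I_p + 'I_q)) : nat * nat :=
    match x with
    | Some (inl a) => (a.+1 + height D2, 0)
    | Some (inr b) => (height D2, nat_of_ord b)
    | None => (0, width D1)
    end.
  apply: (shape_distribution (coord := coord) _ _ _ _ shD (hook_ne_distribution pq q_gt0)).
  - move=> [[a|b]|] [[a'|b']|] //= []; try lia.
      by move=> e; congr (Some (inl _)); apply: ord_inj; lia.
    by move=> /ord_inj->.
  - move=> c; rewrite in_dsum; split.
      case=> -[[i j]]; last by move=> /memD2[-> ->] <-; exists None.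
      move=> /memD1 /= [[-> jq] <-|[i_bnd ->] <-].
        by exists (Some (inr (Ordinal jq))).
      have ip : i.-1 < p by lia.
      by exists (Some (inl (Ordinal ip))); congr (_, _); rewrite /=; lia.
    move=> [[[a|b]|] <-]; last by right; exists (0, 0).
      by left; exists (a.+1, 0) => //; apply: legD1.
    by left; exists (0, nat_of_ord b) => //; apply: armD1.
  - move=> [[a|b]|] [[a'|b']|]; rewrite /cell_before /=; try (have := armW b);
      try (have := armW b'); lia.
  - move=> [[a|b]|] [[a'|b']|] /=; lia.
pose coord (x : option ('I_p + 'I_q)) : nat * nat :=
  match x with
  | Some (inl a) => (a.+1, width D2)
  | Some (inr b) => (0, b + width D2)
  | None => (height D1, 0)
  end.
apply: (shape_distribution (coord := coord) _ _ _ _ shD (hook_sw_distribution pq q_gt0)).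
- move=> [[a|b]|] [[a'|b']|] //= []; try lia.
    by move=> /ord_inj->.
  by move=> e; congr (Some (inr _)); apply: ord_inj; lia.
- move=> c; rewrite in_dsum; split.
    case=> -[[i j]]; first by move=> /memD2[-> ->] <-; exists None.
    move=> /memD1 /= [[-> jq] <-|[i_bnd ->] <-].
      by exists (Some (inr (Ordinal jq))).
    have ip : i.-1 < p by lia.
    by exists (Some (inl (Ordinal ip))); congr (_, _); rewrite /=; lia.
  move=> [[[a|b]|] <-]; last by left; exists (0, 0).
    by right; exists (a.+1, 0) => //; apply: legD1.
  by right; exists (0, nat_of_ord b) => //; apply: armD1.
- move=> [[a|b]|] [[a'|b']|]; rewrite /cell_before /=; try (have := legH a);
    try (have := legH a'); lia.
- move=> [[a|b]|] [[a'|b']|] /=; try (have := legH a); try (have := legH a'); lia.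
Qed.

Lemma near_hook_c_distribution :
  near_hook_c m.+1 k D ->
  diagram_distribution (n := m.+1) D k (fun J => #|starts J| - 1).
Proof.
move=> [k_bnd shD]; have [q qE] : exists q, q = m.+1 - k by exists (m.+1 - k).
have [p pE] : exists p, p = k - 1 by exists (k - 1).
have pq : p + q = m by lia.
have p_gt0 : 0 < p by lia.
have q_gt1 : 1 < q by lia.
have -> : k = p.+1 by lia.
have k2E : k - 2 = p.-1 by lia.
rewrite -qE k2E in shD.
have memE (c : nat * nat) : c \in straight [:: q, 2 & nseq p.-1 1] <->
    [\/ c.1 = 0 /\ c.2 < q, 0 < c.1 <= p /\ c.2 = 0 | c = (1, 1)].
  rewrite in_straight; case: c => [[|[|i]] j] /=.
  - by split=> [jq|[[_ ->]|[]|]] //; constructor 1.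
  - case: j => [|[|j]] /=; split=> //; try by move=> _; constructor 2.
      by move=> _; constructor 3.
    by case=> [[]|[]|[]].
  - rewrite nth_nseq; case: ifP => ip; split; try by case=> [[]|[]|[]] /=; lia.
      by move=> j0; constructor 2 => /=; lia.
    by [].
pose coord (x : option ('I_p + 'I_q)) : nat * nat :=
  match x with
  | Some (inl a) => (a.+1, 0)
  | Some (inr b) => (0, nat_of_ord b)
  | None => (1, 1)
  end.
have q_gt0 : 0 < q := ltnW q_gt1.
apply: (shape_distribution (coord := coord) _ _ _ _ shD
         (hook_inner_distribution pq q_gt0 p_gt0 q_gt1)).
- by move=> [[a|b]|] [[a'|b']|] //= [] => [/ord_inj->|/ord_inj->].
- move=> c; rewrite memE; split.
    case: c => i j /= [[-> jq]|[i_bnd ->]|->]; last by exists None.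
      by exists (Some (inr (Ordinal jq))).
    have ip : i.-1 < p by lia.
    by exists (Some (inl (Ordinal ip))); congr (_, _); rewrite /=; lia.
  move=> [[[a|b]|] <-]; last by constructor 3.
    by constructor 2; rewrite /= ltn_ord.
  by constructor 1; rewrite /= ltn_ord.
- move=> [[a|b]|] [[a'|b']|]; rewrite /cell_before /lt_inner /=; lia.
- move=> [[a|b]|] [[a'|b']|] /=; lia.
Qed.
End Shapes.

Lemma or_reverse_distribution m k (P : diagram -> Prop) (N : {set 'I_m.+1} -> nat) D :
  (forall J : {set 'I_m.+1}, N (@cyc_neg m @^-1: J) = N J) ->
  (forall E, P E -> diagram_distribution E k N) ->
  or_reverse P D -> diagram_distribution D k N.
Proof.
move=> N_neg distP [/distP //|/distP]; exact: reverse_distribution.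
Qed.

Theorem theorem3p11 (lam mu : seq nat) (n k : nat)
  (lam_part : is_part lam) (mu_part : is_part mu) (mu_lam : part_incl mu lam)
  (n_ge2 : 2 <= n) (size_n : #|` skew lam mu| = n)
  (nh : or_reverse (near_hook n k) (skew lam mu)) :
  (forall T : {ffun skew lam mu -> 'I_n},
     T \in SYT n (skew lam mu) -> #|cDes k T| = k) /\
  (forall J : {set 'I_n}, #|J| = k ->
     [/\ or_reverse (near_hook_a n k) (skew lam mu) ->
           #|cDes_fiber (skew lam mu) k J| = 1,
         or_reverse (near_hook_b n k) (skew lam mu) ->
           #|cDes_fiber (skew lam mu) k J| = #|cyclic_runs J|
       & or_reverse (near_hook_c n k) (skew lam mu) ->
           #|cDes_fiber (skew lam mu) k J| = #|cyclic_runs J| - 1]).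
Proof.
case: n n_ge2 {size_n} nh => // m _ nh; set D := skew lam mu in nh *.
have distA : or_reverse (near_hook_a m.+1 k) D ->
    diagram_distribution D k (fun J : {set 'I_m.+1} => 1).
  by apply: or_reverse_distribution => // E; apply: near_hook_a_distribution.
have distB : or_reverse (near_hook_b m.+1 k) D ->
    diagram_distribution D k (fun J : {set 'I_m.+1} => #|starts J|).
  apply: or_reverse_distribution => [J|E]; first exact: card_starts_neg.
  exact: near_hook_b_distribution.
have distC : or_reverse (near_hook_c m.+1 k) D ->
    diagram_distribution D k (fun J : {set 'I_m.+1} => #|starts J| - 1).
  apply: or_reverse_distribution => [J|E]; first by rewrite card_starts_neg.
  exact: near_hook_c_distribution.
have k_lt : k < m.+1.
  by case: nh => [] [[k_bnd _]|[k_bnd _]|[k_bnd _]]; lia.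
split.
  have [dA|dB|dC] : [\/ or_reverse (near_hook_a m.+1 k) D,
      or_reverse (near_hook_b m.+1 k) D | or_reverse (near_hook_c m.+1 k) D].
    by case: nh => [] [nh|nh|nh];
      [constructor 1|constructor 2|constructor 3|constructor 1|constructor 2|constructor 3];
      (by left) || (by right).
  - by have [cd _] := diagram_distributionE (distA dA).
  - by have [cd _] := diagram_distributionE (distB dB).
  - by have [cd _] := diagram_distributionE (distC dC).
move=> J cJ.
have JT : J != setT by apply: contraTneq k_lt => JT; rewrite -cJ JT cardsT card_ord ltnn.
rewrite card_cyclic_runs //; split.
- by move=> /distA /diagram_distributionE[_ ->].
- by move=> /distB /diagram_distributionE[_ ->].
- by move=> /distC /diagram_distributionE[_ ->].
Qed.
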